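(* Consider an instance of $\texttt{SoftCumulative}$ with activity set $A$, current domains $D(\cdot)$, horizon $m$ and limits $ideal\_capa\le max\_capa$. Let $a_i,a_j\in A$ be two activities (possibly the same) with $\min(D(start[a_i]))<\max(D(end[a_j]))$, and let $$\mathrm{Area}_{(a_i,a_j)}=\sum_{t\in[\min(D(start[a_i])),\,\max(D(end[a_j]))[}\bigl(ideal\_capa+\max(D(costVar[t]))\bigr).$$ If $\sum_{a\in S_{(a_i,a_j)}}W_{(a_i,a_j)}(a)>\mathrm{Area}_{(a_i,a_j)}$, then the constraint fails; that is, $\texttt{SoftCumulative}$ has no solution with respect to the current domains.
   Context: Time is discrete: points in time are integers, and $[x,y[$ denotes $\{t\in\mathbb{Z}: x\le t<y\}$. Each variable $x$ is integer-valued with a current finite nonempty domain $D(x)$, with minimum $\min(D(x))$ and maximum $\max(D(x))$. $A=\{a_1,\dots,a_n\}$ is a set of non-preemptive activities scheduled between time $0$ and $m$ (starts and ends lie in $\{0,\dots,m\}$). Each $a\in A$ has variables $start[a]$, $dur[a]$ (duration), $end[a]$ and $res[a]$ (amount of resource consumed, or height). Each activity consumes a positive amount of the resource (durations and heights are positive). For an assignment of the variables, the cumulated height at time $t$ is $h_t=\sum_{a\in A,\ start[a]\le t<end[a]}\min(D(res[a]))$. $\texttt{SoftCumulative}$ has two integer resource limits $ideal\_capa\le max\_capa$ and, for each point in time $t\in\{0,\dots,m-1\}$, an integer variable $costVar[t]$. It enforces: (C1) $start[a]+dur[a]=end[a]$ for every $a\in A$; (C2) $h_t\le max\_capa$ for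 every $t$; (C3) $costVar[t]=\max(0,h_t-ideal\_capa)$ for every $t \in\{0,\dots,m-1\}$. A solution with respect to the current domains is an assignment of each variable to a value of its current domain satisfying C1, C2 and C3. For $a_i,a_j\in A$ (possibly equal) with $\min(D(start[a_i]))<\max(D(end[a_j]))$, let $$S_{(a_i,a_j)}=\{a\in A:\ \min(D(start[a_i]))\le\min(D(start[a]))<\max(D(end[a_j]))\},$$ and for $a\in S_{(a_i,a_j)}$ let $$W_{(a_i,a_j)}(a)=\min(D(res[a]))\cdot\min\bigl[\min(D(dur[a])),\ \max\bigl(0,\ \max(D(end[a_j]))-\max(D(start[a]))\bigr)\bigr].$$ *)

(* Defs.v *)
From mathcomp Require Import all_boot all_order all_algebra finmap.

Set Implicit Arguments.
Unset Strict Implicit.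
Unset Printing Implicit Defensive.

Import Order.TTheory GRing.Theory Num.Theory.
Local Open Scope ring_scope.

Record domain := Domain {
  dom_set :> {fset int};
  dom_neq0 : dom_set != fset0
}.

(* The initial value of the iteration is an element of the nonempty set D, so
   these are the true minimum and maximum (see dminP and dmaxP). *)
Definition dmin (D : domain) : int :=
  \big[Num.min/head 0 (dom_set D)]_(x <- dom_set D) x.
Definition dmax (D : domain) : int :=
  \big[Num.max/head 0 (dom_set D)]_(x <- dom_set D) x.

Lemma dom_head (D : domain) : head 0 (dom_set D) \in dom_set D.
Proof.
have [x xD] := fset0Pn _ (dom_neq0 D).
move: xD; change (x \in enum_fset D -> head 0 (enum_fset D) \in enum_fset D).
by case: (enum_fset D) => [//|y s] _; rewrite mem_head.
Qed.

Lemma dminP (D : domain) :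
  (dmin D \in dom_set D) /\ (forall x, x \in dom_set D -> dmin D <= x).
Proof.
split; last by move=> x xD; apply: (@ge_bigmin_seq _ _ _ _ _ _ xpredT id).
rewrite /dmin big_seq; elim/big_ind: _ => [|x y xD yD|//]; first exact: dom_head.
by rewrite /Num.min; case: ifP.
Qed.

Lemma dmaxP (D : domain) :
  (dmax D \in dom_set D) /\ (forall x, x \in dom_set D -> x <= dmax D).
Proof.
split; last by move=> x xD; apply: (@le_bigmax_seq _ _ _ _ _ _ xpredT id).
rewrite /dmax big_seq; elim/big_ind: _ => [|x y xD yD|//]; first exact: dom_head.
by rewrite /Num.max; case: ifP.
Qed.

(* An instance: activities A, horizon m, current domains and limits. *)
Record softCumulative (A : finType) (m : nat) := SoftCumulative {
  Dstart : A -> domain;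
  Ddur : A -> domain;
  Dend : A -> domain;
  Dres : A -> domain;
  DcostVar : 'I_m -> domain;
  ideal_capa : int;
  max_capa : int;
  ideal_le_max : ideal_capa <= max_capa;
  Dstart_horizon : forall a x, x \in dom_set (Dstart a) -> 0 <= x <= m%:Z;
  Dend_horizon : forall a x, x \in dom_set (Dend a) -> 0 <= x <= m%:Z;
  Ddur_gt0 : forall a x, x \in dom_set (Ddur a) -> 0 < x;
  Dres_gt0 : forall a x, x \in dom_set (Dres a) -> 0 < x
}.

Record assignment (A : finType) (m : nat) := Assignment {
  vstart : A -> int;
  vdur : A -> int;
  vend : A -> int;
  vres : A -> int;
  vcostVar : 'I_m -> int
}.

(* As in the definition of h_t, an activity contributes the minimum of the
   domain of its height, not the height assigned by s. *)
Definition height (A : finType) (m : nat) (I : softCumulative A m)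
    (s : assignment A m) (t : int) : int :=
  \sum_(a : A | vstart s a <= t < vend s a) dmin (Dres I a).

Record solution (A : finType) (m : nat) (I : softCumulative A m)
    (s : assignment A m) : Prop := Solution {
  sol_start : forall a, vstart s a \in dom_set (Dstart I a);
  sol_dur : forall a, vdur s a \in dom_set (Ddur I a);
  sol_end : forall a, vend s a \in dom_set (Dend I a);
  sol_res : forall a, vres s a \in dom_set (Dres I a);
  sol_costVar : forall t, vcostVar s t \in dom_set (DcostVar I t);
  sol_C1 : forall a, vstart s a + vdur s a = vend s a;
  sol_C2 : forall t : int, height I s t <= max_capa I;
  sol_C3 : forall t : 'I_m,
    vcostVar s t = Num.max 0 (height I s (t : nat)%:Z - ideal_capa I)
}.

Definition Sset (A : finType) (m : nat) (I : softCumulative A m) (ai aj : A) :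
    {set A} :=
  [set a | dmin (Dstart I ai) <= dmin (Dstart I a) < dmax (Dend I aj)].

Definition W (A : finType) (m : nat) (I : softCumulative A m) (ai aj a : A) :
    int :=
  dmin (Dres I a) *
    Num.min (dmin (Ddur I a))
            (Num.max 0 (dmax (Dend I aj) - dmax (Dstart I a))).

(* By Dstart_horizon and Dend_horizon the summation interval lies within
   [0, m[, so letting t range over 'I_m omits no point of it. *)
Definition Area (A : finType) (m : nat) (I : softCumulative A m) (ai aj : A) :
    int :=
  \sum_(t < m | dmin (Dstart I ai) <= (t : nat)%:Z < dmax (Dend I aj))
    (ideal_capa I + dmax (DcostVar I t)).

(* Main.v *)
Require Import Defs.
From mathcomp Require Import all_boot all_order all_algebra finmap.
From mathcomp Require Import zify.

Import Order.TTheory GRing.Theory Num.Theory.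
Local Open Scope ring_scope.

(** If a solution exists, (C3) bounds the total height over the window
    from [lo = dmin (Dstart I ai)] to [dmax (Dend I aj)] by the area.
    Conversely every activity of S starts at or after [lo], no later than its latest start, and lasts at least its
    minimal duration, so it spends at least [W a / dmin (Dres a)] time points
    inside the window; exchanging the sums over time and activities then gives
    [\sum_a W a <= Area]. *)

Lemma count_window_ge (m : nat) (p q : int) : 0 <= p -> q <= m%:Z ->
  q - p <= \sum_(t < m | p <= (t : nat)%:Z < q) 1.
Proof.
move=> p0 qm.
(* Truncating [q] at [m] gives a bound that makes sense for every horizon, so induction on [m]
   applies. *)
suff: Num.min q m%:Z - p <= \sum_(t < m | p <= (t : nat)%:Z < q) 1.
  by rewrite min_l.
elim: m {qm} => [|m IHm]; first by rewrite big_ord0; lia.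
rewrite big_mkcond big_ord_recr -big_mkcond /=.
have : 0 <= \sum_(t < m | p <= (t : nat)%:Z < q) (1 : int) by apply: sumr_ge0.
by move: IHm; move: (\sum_(t < m | _) _) => c; case: ifP; lia.
Qed.

Section Solution.

Variables (A : finType) (m : nat) (I : softCumulative A m).
Variable s : assignment A m.
Hypothesis solI : solution I s.

Lemma dmin_res_ge0 (a : A) : 0 <= dmin (Dres I a).
Proof. exact: ltW (Dres_gt0 (dminP _).1). Qed.

Lemma height_le_costVar (t : 'I_m) :
  height I s (t : nat)%:Z <= ideal_capa I + dmax (DcostVar I t).
Proof.
have := (dmaxP (DcostVar I t)).2 _ (sol_costVar solI t).
by rewrite (sol_C3 solI); lia.
Qed.

Lemma W_le_window (ai aj a : A) : a \in Sset I ai aj ->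
  W I ai aj a <=
  \sum_(t < m | dmin (Dstart I ai) <= (t : nat)%:Z < dmax (Dend I aj))
    (if vstart s a <= (t : nat)%:Z < vend s a then dmin (Dres I a) else 0).
Proof.
rewrite inE => /andP[lo_a _]; rewrite /W.
set w := Num.min _ _.
have r0 := dmin_res_ge0 a.
have sa := sol_start solI a; have ea := sol_end solI a.
have minstart := (dminP _).2 _ sa; have maxstart := (dmaxP _).2 _ sa.
have mindur := (dminP _).2 _ (sol_dur solI a).
have C1 := sol_C1 solI a.
have /andP[s0 _] := Dstart_horizon sa; have /andP[_ em] := Dend_horizon ea.
have d0 := Ddur_gt0 (dminP (Ddur I a)).1.
(* The first [w] time points of [a] stay in the window even for the latest start. If [w = 0] this
   block is empty and may lie beyond the window, hence the guard. *)
have [w_end w_hi] : vstart s a + w <= vend s a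
    /\ (0 < w -> vstart s a + w <= dmax (Dend I aj)) by lia.
have : w <= \sum_(t < m | vstart s a <= (t : nat)%:Z < vstart s a + w) 1.
  by have := count_window_ge m (vstart s a) (vstart s a + w) s0; lia.
move=> /(ler_wpM2l r0)/le_trans; apply.
rewrite mulr_sumr big_mkcond [leRHS]big_mkcond; apply: ler_sum => t _ /=.
rewrite mulr1; case: ifP => [/andP[st tw]|_]; last by do 2?case: ifP.
(* A point [t] of the block forces [0 < w], so [w_hi] applies. *)
by rewrite !ifT //; lia.
Qed.

Lemma sum_W_le_Area (ai aj : A) :
  \sum_(a in Sset I ai aj) W I ai aj a <= Area I ai aj.
Proof.
apply: (@le_trans _ _ (\sum_(t < m |
    dmin (Dstart I ai) <= (t : nat)%:Z < dmax (Dend I aj))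
    height I s (t : nat)%:Z)); last first.
  by apply: ler_sum => t _; apply: height_le_costVar.
(* Moving the condition into the summand makes the range of activities independent of [t], as the
   exchange requires. *)
under [X in _ <= X]eq_bigr => t _ do rewrite /height big_mkcond.
rewrite [leRHS]exchange_big [leLHS]big_mkcond /=; apply: ler_sum => a _.
case: ifP => [|_]; first exact: W_le_window.
(* Activities outside [Sset I ai aj] only add nonnegative height. *)
by apply: sumr_ge0 => t _; case: ifP => // _; apply: dmin_res_ge0.
Qed.

End Solution.

Theorem mainTheorem2 (A : finType) (m : nat) (I : softCumulative A m)
    (ai aj : A) :
  dmin (Dstart I ai) < dmax (Dend I aj) ->
  \sum_(a in Sset I ai aj) W I ai aj a > Area I ai aj ->
  ~ exists s : assignment A m, solution I s.
Proof.
by move=> _ gtArea [s solI]; move: gtArea;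
rewrite ltNge (sum_W_le_Area _ _ _ _ solI).
Qed.
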